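(* Let $k,n\in\mathbb{N}$, let $a_1<b_1<a_2<b_2<\ldots<a_k<b_k$ be arbitrary real numbers, $E:=\bigcup_{\ell=1}^k[a_\ell,b_\ell]$, let $\mathbf{r}=(r_1,\dots,r_n)\in(0,\infty)^n$ be an arbitrary exponent system, and let $w:E\to[0,\infty)$ be an upper semicontinuous weight which is non-zero at more than $n$ points of $E$, where the points $a_1$ and $b_k$ are counted with weight $1/2$ and all other points with weight $1$. Then the restricted and unrestricted Bojanov–Chebyshev constants satisfy \[ C_{\mathbf{r}}^w(E)\le R_{\mathbf{r}}^w(E)\le C(k,\mathbf{r})\,C_{\mathbf{r}}^w(E), \] where $C(k,\mathbf{r}):=2^{\max\{\sum_{i\in A}r_i\ :\ A\subseteq\{1,\dots,n\},\ |A|\le k-1\}}$ (which equals $2^{\max\{r_{i_1}+\ldots+r_{i_{k-1}}\,:\,1\le i_1<\ldots<i_{k-1}\le n\}}$ when $k-1\le n$). In particular, if $\mathbf{r}=(1,\dots,1)$, so that one deals with absolute values of ordinary monic algebraic polynomials of degree $n$, then, writing $C_n^w(E)$ and $R_n^w(E)$ for the corresponding constants, $C_n^w(E)\le R_n^w(E)\le2^{k-1}C_n^w(E)$, independently of the value of $n$.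
   Context: For a function $Q$ on $E$ put $\|Q\|_w:=\sup_{t\in E}|Q(t)|w(t)$. Let $\mathcal{P}_{\mathbf{r}}(E)$ be the set of functions $t\mapsto\prod_{j=1}^n|t-x_j|^{r_j}$ with $x_1,\dots,x_n\in E$, $x_1\le\ldots\le x_n$, and let $\mathcal{P}_{\mathbf{r}}$ be the set of functions $t\mapsto\prod_{j=1}^n|t-(x_j+iy_j)|^{r_j}$ with $-\infty<x_1\le\ldots\le x_n<\infty$ and $y_1,\dots,y_n\in\mathbb{R}$. The restricted Bojanov–Chebyshev constant is $R_{\mathbf{r}}^w(E):=\inf_{Q\in\mathcal{P}_{\mathbf{r}}(E)}\|Q\|_w$ and the unrestricted one is $C_{\mathbf{r}}^w(E):=\inf_{Q\in\mathcal{P}_{\mathbf{r}}}\|Q\|_w$ (these infima are written as minima in the paper). *)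

(* Defs.v *)
From HB Require Import structures.
From mathcomp Require Import all_boot all_order all_algebra.
From mathcomp Require Import all_classical all_reals all_analysis.
From mathcomp Require Import complex.
Set Implicit Arguments.
Unset Strict Implicit.
Unset Printing Implicit Defensive.
Import Order.TTheory GRing.Theory Num.Theory.
Import numFieldNormedType.Exports.
Local Open Scope classical_set_scope.
Local Open Scope ring_scope.

(* Weights and generalized polynomials are total functions on R of which only
   the values on E are ever used. *)

Definition interval_union (R : realType) (k : nat) (a b : 'I_k -> R) : set R :=
  \bigcup_(l in [set: 'I_k]) `[a l, b l]%classic.

(* Upper semicontinuity of the restriction of w to E, for the topology of E. *)
Definition upper_semicontinuous_on (R : realType) (E : set R) (w : R -> R) :=
  forall t, E t -> forall c, w t < c ->
    \forall s \near within E (nbhs t), w s < c.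

Definition point_weight (R : realType) (alpha beta t : R) : R :=
  if (t == alpha) || (t == beta) then 2^-1 else 1.

(* Extended-real valued; it is never -oo on a nonempty E when w >= 0. *)
Definition wnorm (R : realType) (E : set R) (w Q : R -> R) : \bar R :=
  ereal_sup [set (`|Q t| * w t)%:E | t in E].

(* The nodes are ordered, so that the j-th smallest one gets exponent r j. *)
Definition restricted_gpoly (R : realType) (n : nat) (r : 'I_n -> R)
    (E : set R) : set (R -> R) :=
  [set Q | exists x : 'I_n -> R,
     [/\ forall j, E (x j),
         forall i j : 'I_n, (i <= j)%N -> x i <= x j &
         Q = (fun t => \prod_(j < n) `|t - x j| `^ r j)]].

(* normc is the R-valued complex modulus. *)
Definition gpoly (R : realType) (n : nat) (r : 'I_n -> R) : set (R -> R) :=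
  [set Q | exists x y : 'I_n -> R,
     (forall i j : 'I_n, (i <= j)%N -> x i <= x j) /\
     Q = (fun t => \prod_(j < n) ComplexField.Normc.normc (t%:C - (x j +i* y j))%C `^ r j)].

Definition restricted_constant (R : realType) (n : nat) (r : 'I_n -> R)
    (E : set R) (w : R -> R) : \bar R :=
  ereal_inf [set wnorm E w Q | Q in restricted_gpoly r E].

Definition unrestricted_constant (R : realType) (n : nat) (r : 'I_n -> R)
    (E : set R) (w : R -> R) : \bar R :=
  ereal_inf [set wnorm E w Q | Q in gpoly r].

(* The default value 0 of the maximum is the sum over the empty set A. *)
Definition BC_factor (R : realType) (k n : nat) (r : 'I_n -> R) : R :=
  2 `^ (\big[Num.max/0]_(A : {set 'I_n} | (#|A| <= k.-1)%N)
          \sum_(i in A) r i).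

(* The same constant through increasing index systems i_1 < ... < i_(k-1);
   such systems exist only if k - 1 <= n. *)
Definition BC_factor_increasing (R : realType) (k n : nat) (r : 'I_n -> R) : R :=
  2 `^ (\big[Num.max/0]_(i : {ffun 'I_k.-1 -> 'I_n} |
            [forall p : 'I_k.-1, forall q : 'I_k.-1, (p < q)%N ==> (i p < i q)%N])
          \sum_(p < k.-1) r (i p)).

(* Main.v *)
Require Import Defs.
From mathcomp Require Import all_boot all_order all_algebra.
From mathcomp Require Import all_classical all_reals all_analysis.
From mathcomp Require Import complex ring lra.

(** Imaginary parts only increase the factors of a generalized polynomial on the
    real line, so the unrestricted problem is one about ordered real nodes.
    Given such nodes x, the proof builds ordered nodes in E whose product is at
    most 2^(sum of r_j over A) times the product for x, at every point of E,
    for some set A of at most k - 1 indices. As w is nonnegative on E, such a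
    pointwise bound passes to the weighted norms, and then to the infima.

    The nodes are changed in three stages. Clamping them to the convex hull of
    E moves no node away from any point of E ([clamp_nodes]).

    Next, let two nodes x_i <= x_j lie in the same gap of E, with no other node
    of the gap outside [x_i, x_j]. Replace them by x_i - s / r_i and
    x_j + s / r_j, which keeps r_i x_i + r_j x_j constant. For t outside
    the gap, the derivative in s of the logarithm of
    |t - x_i|^r_i |t - x_j|^r_j is 1 / (t - x_i) - 1 / (t - x_j) <= 0,
    so the product decreases on E; [spread_pair_le] gets this from
    1 + z <= exp z. Increasing s until one of the two nodes reaches the
    end of the gap reduces the number of nodes off E ([spread_gap]), and
    after finitely many such moves every gap contains at most one node
    ([separate_nodes]). As E has k components, at most k - 1 nodes remain
    off E ([card_off_separated]).

    Finally, each remaining node x_j moves to a point p of E nearest to it. For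
    t in E, |t - p| <= |t - x_j| + |x_j - p| <= 2 |t - x_j|, so
    this costs a factor 2^r_j, for these at most k - 1 nodes only
    ([project_nodes]). All three stages preserve the order of the nodes, hence
    the attribution of the exponents. *)

Set Implicit Arguments.
Unset Strict Implicit.
Unset Printing Implicit Defensive.
Import Order.TTheory GRing.Theory Num.Theory.
Import numFieldNormedType.Exports.
Local Open Scope classical_set_scope.
Local Open Scope ring_scope.

(** * Node systems *)

Definition gprod (R : realType) (n : nat) (r x : 'I_n -> R) (t : R) : R :=
  \prod_(j < n) `|t - x j| `^ r j.

Definition ordered_nodes (R : realType) (n : nat) (x : 'I_n -> R) :=
  forall i j : 'I_n, (i <= j)%N -> x i <= x j.

Definition in_hull (R : realType) (E : set R) (x : R) :=
  (exists2 e, E e & e <= x) /\ (exists2 e, E e & x <= e).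

Definition off_nodes (R : realType) (n : nat) (E : set R) (x : 'I_n -> R) :
  {set 'I_n} := [set j | `[< ~ E (x j) >]]%SET.

Lemma offP (R : realType) (n : nat) (E : set R) (x : 'I_n -> R) (j : 'I_n) :
  reflect (~ E (x j)) (j \in off_nodes E x).
Proof. by rewrite inE; exact: asboolP. Qed.

(** * Spreading two factors apart *)

Lemma le_powR (R : realType) (p x y : R) :
  0 < p -> 0 <= x -> x <= y -> x `^ p <= y `^ p.
Proof.
move=> /ltW p0 x0 xy; apply: (ge0_ler_powR p0) => //.
by rewrite nnegrE (le_trans x0).
Qed.

(** The logarithm is concave, so it lies below its tangent at u: this is
    p ln (u + s / p) <= p ln u + s / u. The number s may be negative, and
    u + s / p may vanish. *)
Lemma powR_le_expR (R : realType) (p u s : R) : 0 < p -> 0 < u ->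
  0 <= u + s / p -> (u + s / p) `^ p <= u `^ p * expR (s / u).
Proof.
move=> p0 u0 us0.
have -> : expR (s / u) = expR (s / (p * u)) `^ p.
  by rewrite -expRM; congr expR; field; rewrite !gt_eqF.
rewrite -powRM ?expR_ge0 ?(ltW u0) //.
apply: le_powR => //.
have -> : u + s / p = u * (1 + s / (p * u)) by field; rewrite !gt_eqF.
by rewrite (ler_wpM2l (ltW u0)) ?expR_ge1Dx.
Qed.

(** With u and v the distances from a point to the two nodes, the two tangent
    bounds multiply to a factor exp (s / u - s / v) <= 1, because the farther
    node is the one that recedes. *)
Lemma spread_le (R : realType) (p q u v s : R) : 0 < p -> 0 < q -> 0 <= s ->
  v <= u -> s / q <= v ->
  (u + s / p) `^ p * (v - s / q) `^ q <= u `^ p * v `^ q.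
Proof.
move=> p0 q0 s0 vu sv.
have sq0 : 0 <= s / q by rewrite divr_ge0 ?(ltW q0).
have sp0 : 0 <= s / p by rewrite divr_ge0 ?(ltW p0).
have := le_trans sq0 sv; rewrite le_eqVlt => /predU1P[v0|v0].
  have /eqP : s / q = 0 by apply/eqP; rewrite eq_le sq0 v0 sv.
  rewrite mulf_eq0 invr_eq0 (gt_eqF q0) orbF => /eqP ->.
  by rewrite !mul0r addr0 subr0.
have u0 : 0 < u by exact: lt_le_trans vu.
have Hu := @powR_le_expR _ p u s p0 u0 (addr_ge0 (ltW u0) sp0).
have Hv : (v - s / q) `^ q <= v `^ q * expR (- s / v).
  by rewrite -mulNr; apply: powR_le_expR => //; rewrite mulNr subr_ge0.
apply: (le_trans (ler_pM (powR_ge0 _ _) (powR_ge0 _ _) Hu Hv)).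
rewrite mulrACA -expRD -[leRHS]mulr1 ler_wpM2l ?mulr_ge0 ?powR_ge0 //.
rewrite -[leRHS]expR0 ler_expR mulNr subr_le0 ler_wpM2l //.
by rewrite lef_pV2 ?posrE.
Qed.

(** Seen from the left of the pair, the nodes exchange their roles: the node x
    is then the nearer one and the one that approaches. Both sides are thus the
    same inequality between distances. *)
Lemma spread_pair_le (R : realType) (p q x y s t : R) :
  0 < p -> 0 < q -> 0 <= s -> x <= y -> t <= x - s / p \/ y + s / q <= t ->
  `|t - (x - s / p)| `^ p * `|t - (y + s / q)| `^ q
    <= `|t - x| `^ p * `|t - y| `^ q.
Proof.
move=> p0 q0 s0 xy.
have sq0 : 0 <= s / q by rewrite divr_ge0 ?(ltW q0).
have sp0 : 0 <= s / p by rewrite divr_ge0 ?(ltW p0).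
case=> ht.
  rewrite mulrC [leRHS]mulrC !ler0_norm; try lra.
  have -> : - (t - (y + s / q)) = (y - t) + s / q by ring.
  have -> : - (t - (x - s / p)) = (x - t) - s / p by ring.
  by rewrite !opprB; apply: spread_le => //; lra.
rewrite !ger0_norm; try lra.
have -> : t - (x - s / p) = (t - x) + s / p by ring.
have -> : t - (y + s / q) = (t - y) - s / q by ring.
by apply: spread_le => //; lra.
Qed.

(** * At most one node in each gap *)

Lemma gap_endpoints (R : realType) (k : nat) (a b : 'I_k -> R) (x : R) :
  (forall l, a l < b l) -> let E := interval_union a b in
  in_hull E x -> ~ E x ->
  exists L U, [/\ E L, E U, L < x < U & forall e, E e -> e <= L \/ U <= e].
Proof.
move=> hab E [[e [l1 _] /=]]; rewrite in_itv /= => /andP[al1 _] ex.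
move=> [f [l2 _] /=]; rewrite in_itv /= => /andP[_ fb2] xf Ex.
have side l : (b l < x) || (x < a l).
  case: (ltP (b l) x) => //= xb; rewrite ltNge; apply/negP => ax.
  by apply: Ex; exists l => //=; rewrite in_itv /= ax.
have P1 : b l1 < x.
  by have := side l1; rewrite [x < _]ltNge (le_trans al1 ex) orbF.
have P2 : x < a l2.
  by have := side l2; rewrite [_ < x]ltNge (le_trans xf fb2).
pose L := [arg max_(l > l1 | b l < x) b l]%O.
pose U := [arg min_(l < l2 | x < a l) a l]%O.
exists (b L), (a U).
rewrite /L /U; case: arg_maxP => // L0 hL1 hL2; case: arg_minP => // U0 hU1 hU2.
split.
- by exists L0 => //=; rewrite in_itv /= lexx ltW.
- by exists U0 => //=; rewrite in_itv /= lexx ltW.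
- by rewrite hL1.
move=> g [l _] /=; rewrite in_itv /= => /andP[ag gb].
case/orP: (side l) => [/hL2|/hU2] h; [left|right].
- exact: le_trans gb h.
- exact: le_trans h ag.
Qed.

(** The outermost nodes of the gap are the ones to move apart: no node lies
    between them and the ends of the gap, so their shift preserves the order of
    the nodes. *)
Lemma spread_gap (R : realType) (n : nat) (r x : 'I_n -> R) (E : set R)
    (L U : R) (i0 j0 : 'I_n) :
  (forall j, 0 < r j) -> ordered_nodes x -> (forall j, in_hull E (x j)) ->
  E L -> E U -> (forall e, E e -> e <= L \/ U <= e) ->
  i0 != j0 -> L < x i0 < U -> L < x j0 < U ->
  exists x', [/\ ordered_nodes x', forall j, in_hull E (x' j),
    forall t, E t -> gprod r x' t <= gprod r x t &
    (#|off_nodes E x'| < #|off_nodes E x|)%N].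
Proof.
move=> r0 xo xE EL EU gap ij0 hi0 hj0.
pose i := [arg min_(p < i0 | (L < x p < U)%R) val p]%N.
pose j := [arg max_(p > i0 | (L < x p < U)%R) val p]%N.
have [Pi iP] : L < x i < U /\ forall p : 'I_n, L < x p < U -> (i <= p)%N.
  by rewrite /i; case: arg_minnP.
have [Pj jP] : L < x j < U /\ forall p : 'I_n, L < x p < U -> (p <= j)%N.
  by rewrite /j; case: arg_maxnP.
have ij : (i < j)%N.
  rewrite ltn_neqAle (leq_trans (iP _ hi0) (jP _ hi0)) andbT.
  apply: contra ij0 => /eqP e; apply/eqP/val_inj/eqP; rewrite /= eqn_leq.
  by apply/andP; split; [apply: leq_trans (jP _ hi0) _|
    apply: leq_trans (jP _ hj0) _]; rewrite -e; exact: iP.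
have ji : (j == i) = false by apply/negbTE; rewrite -val_eqE /= neq_ltn ij orbT.
have xij : x i <= x j := xo _ _ (ltnW ij).
have [/andP[Li iU] /andP[Lj jU]] := (Pi, Pj).
have lowi (p : 'I_n) : (p < i)%N -> x p <= L.
  move=> pi; rewrite leNgt; apply/negP => Lp.
  have : (i <= p)%N by apply: iP; rewrite Lp (le_lt_trans (xo _ _ (ltnW pi))).
  by rewrite leqNgt pi.
have uppj (p : 'I_n) : (j < p)%N -> U <= x p.
  move=> jp; rewrite leNgt; apply/negP => pU.
  have : (p <= j)%N.
    by apply: jP; rewrite pU (lt_le_trans Lj (xo _ _ (ltnW jp))).
  by rewrite leqNgt jp.
(* The largest shift that leaves both nodes in the closed gap; one of them
   then reaches an end of the gap, a point of E. *)
pose s := Num.min (r i * (x i - L)) (r j * (U - x j)).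
have s0 : 0 <= s.
  by rewrite le_min !mulr_ge0 ?subr_ge0 // ltW.
have si : s / r i <= x i - L.
  by rewrite ler_pdivrMr // mulrC ge_min lexx.
have sj : s / r j <= U - x j.
  by rewrite ler_pdivrMr // mulrC ge_min lexx orbT.
have si0 : 0 <= s / r i by rewrite divr_ge0 ?(ltW (r0 i)).
have sj0 : 0 <= s / r j by rewrite divr_ge0 ?(ltW (r0 j)).
pose x' p := if p == i then x i - s / r i
             else if p == j then x j + s / r j else x p.
have x'i : x' i = x i - s / r i by rewrite /x' eqxx.
have x'j : x' j = x j + s / r j by rewrite /x' ji eqxx.
exists x'; split.
- move=> p q; rewrite /x'.
  case: (eqVneq p i) => [->|pi]; case: (eqVneq q i) => [->|qi] // pq.
  + case: (eqVneq q j) => [_|qj]; first by lra.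
    by have := xo _ _ pq; lra.
  + case: (eqVneq p j) => [pj|pj].
      by move: pq ij; rewrite pj leqNgt => /negbTE ->.
    have /lowi : (p < i)%N by rewrite ltn_neqAle pq andbT; exact: pi.
    by lra.
  + case: (eqVneq p j) => [pj|pj]; case: (eqVneq q j) => [qj|qj] //.
    * have /uppj : (j < q)%N.
        by rewrite ltn_neqAle eq_sym -{2}pj pq andbT; exact: qj.
      by lra.
    * by have := xo _ _ pq; rewrite qj; lra.
    * exact: xo.
- move=> p; rewrite /x'; case: (eqVneq p i) => _.
    by split; [exists L|exists U] => //; lra.
  case: (eqVneq p j) => _ //.
  by split; [exists L|exists U] => //; lra.
- move=> t Et; rewrite /gprod.
  rewrite (bigD1 i) //= (bigD1 j) ?ji //= mulrA.
  rewrite [leRHS](bigD1 i) //= [in leRHS](bigD1 j) ?ji //= mulrA x'i x'j.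
  rewrite (eq_bigr (fun p => `|t - x p| `^ r p)); last first.
    by move=> p /andP[/negbTE pi /negbTE pj]; rewrite /x' pi pj.
  apply: ler_wpM2r; first by apply: prodr_ge0 => p _; exact: powR_ge0.
  apply: spread_pair_le => //.
  by case: (gap _ Et) => ht; [left|right]; lra.
have offi : i \in off_nodes E x.
  by apply/offP => /gap[]; lra.
have offj : j \in off_nodes E x.
  by apply/offP => /gap[]; lra.
apply: proper_card; apply/properP; split.
  apply/fintype.subsetP => p.
  case: (eqVneq p i) => [->//|pi]; case: (eqVneq p j) => [->//|pj].
  by rewrite !inE /x' (negbTE pi) (negbTE pj).
have [hs|hs] : s = r i * (x i - L) \/ s = r j * (U - x j).
- by rewrite /s /Num.min; case: ifP; [left|right].
- exists i => //; apply/offP; apply; rewrite x'i hs.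
  by rewrite mulrAC divff ?gt_eqF // mul1r subKr.
- exists j => //; apply/offP; apply; rewrite x'j hs.
  by rewrite mulrAC divff ?gt_eqF // mul1r addrC subrK.
Qed.

(** Expresses that two nodes never share a gap of E, without naming the gaps. *)
Definition separated (R : realType) (n : nat) (E : set R) (x : 'I_n -> R) :=
  forall i j, i != j -> ~ E (x i) -> ~ E (x j) -> x i <= x j ->
    exists2 e, E e & x i <= e <= x j.

Lemma separate_nodes (R : realType) (k n : nat) (a b : 'I_k -> R)
    (r x : 'I_n -> R) :
  (forall l, a l < b l) -> let E := interval_union a b in
  (forall j, 0 < r j) -> ordered_nodes x -> (forall j, in_hull E (x j)) ->
  exists x', [/\ ordered_nodes x', forall j, in_hull E (x' j),
    forall t, E t -> gprod r x' t <= gprod r x t & separated E x'].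
Proof.
move=> hab E r0; have [m] := ubnP #|off_nodes E x|.
elim: m x => // m IH x; rewrite ltnS => xm xo xE.
have [sep|] := pselect (separated E x); first by exists x; split.
move=> /existsNP[i /existsNP[j /not_implyP[ij]]].
move=> /not_implyP[Ei /not_implyP[Ej /not_implyP[xij nE]]].
have [L [U [EL EU /andP[Li iU] gap]]] := gap_endpoints hab (xE i) Ei.
have jU : x j < U.
  by rewrite ltNge; apply/negP => Uj; apply: nE; exists U; rewrite ?(ltW iU).
have [||y [yo yE yx yoff]] := spread_gap r0 xo xE EL EU gap ij.
- by rewrite Li.
- by rewrite jU (lt_le_trans Li).
have [z [zo zE zy zs]] := IH y (leq_trans yoff xm) yo yE.
by exists z; split => // t Et; exact: le_trans (zy _ Et) (yx _ Et).
Qed.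

(** A node y off E is sent to the number of left endpoints a_l < y. This number
    grows strictly from one gap to a later one. It is positive, and less than
    k, since some component lies to the left of y and some other one to its
    right. *)
Lemma card_off_separated (R : realType) (k n : nat) (a b : 'I_k -> R)
    (x : 'I_n -> R) :
  let E := interval_union a b in
  (forall j, in_hull E (x j)) -> separated E x -> (#|off_nodes E x| <= k.-1)%N.
Proof.
move=> E xE sep.
pose c y := #|[set l | a l < y]%SET|.
have mono i j : i != j -> ~ E (x i) -> ~ E (x j) -> x i <= x j ->
    (c (x i) < c (x j))%N.
  move=> ij Ei Ej xij; have [e Ee /andP[ie ej]] := sep _ _ ij Ei Ej xij.
  have [l _ /=] := Ee; rewrite in_itv /= => /andP[ae eb].
  apply: proper_card; apply/properP; split.
    by apply/fintype.subsetP => m; rewrite !inE => /lt_le_trans; apply.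
  exists l; rewrite inE.
    rewrite lt_neqAle (le_trans ae ej) andbT; apply/eqP => h; apply: Ej.
    by exists l => //=; rewrite in_itv /= -h lexx (le_trans ae eb).
  rewrite -leNgt leNgt; apply/negP => ax; apply: Ei.
  by exists l => //=; rewrite in_itv /= (ltW ax) (le_trans ie eb).
rewrite cardE -(size_map (c \o x)) -(size_iota 1 k.-1).
apply: uniq_leq_size.
  rewrite map_inj_in_uniq ?enum_uniq // => i j.
  rewrite !mem_enum => /offP Ei /offP Ej /= cij.
  apply/eqP; apply: contraT => ij.
  have [xij|/ltW xji] := leP (x i) (x j).
    by have := mono _ _ ij Ei Ej xij; rewrite cij ltnn.
  rewrite eq_sym in ij.
  by have := mono _ _ ij Ej Ei xji; rewrite cij ltnn.
move=> y /mapP[j]; rewrite mem_enum => /offP Ej -> /=.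
have [[e [l _ /=]]] := xE j; rewrite in_itv /= => /andP[ae eb] ej.
move=> [f [m _ /=]]; rewrite in_itv /= => /andP[af fb] jf.
rewrite mem_iota; apply/andP; split.
  apply/card_gt0P; exists l; rewrite inE lt_neqAle (le_trans ae ej) andbT.
  apply/eqP => h; apply: Ej; exists l => //=.
  by rewrite in_itv /= -h lexx (le_trans ae eb).
have k0 : (0 < k)%N := leq_ltn_trans (leq0n m) (ltn_ord m).
rewrite add1n prednK // -[ltnRHS]card_ord -cardsT; apply: proper_card.
apply/properP; split; first exact: finset.subsetT.
exists m; rewrite inE // -leNgt leNgt; apply/negP => ax; apply: Ej.
by exists m => //=; rewrite in_itv /= (ltW ax) (le_trans jf fb).
Qed.

(** * Moving the remaining nodes into E *)

Lemma nearest_point (R : realType) (k : nat) (a b : 'I_k -> R) :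
  (0 < k)%N -> (forall l, a l < b l) -> let E := interval_union a b in
  exists p : R -> R,
    forall x, E (p x) /\ forall e, E e -> `|x - p x| <= `|x - e|.
Proof.
move=> k0 hab E.
(* cl l x is the point of [a l, b l] nearest to x; m x picks the component
   for which it is closest. *)
pose cl l x := Num.max (a l) (Num.min (b l) x).
pose m x := [arg min_(l < Ordinal k0) `|x - cl l x|]%O.
exists (fun x => cl (m x) x) => x; split.
  exists (m x) => //=; rewrite in_itv /= /cl le_max lexx /=.
  by rewrite ge_max (ltW (hab _)) ge_min lexx.
move=> e [l _ /=]; rewrite in_itv /= => /andP[ae eb].
rewrite /m; case: arg_minP => // l' _ /(_ l isT) h; apply: (le_trans h).
rewrite /cl; have := hab l; rewrite /Num.max /Num.min.
case: (ltP (b l) x) => bx abl.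
  rewrite abl !ger0_norm; lra.
case: (ltP (a l) x) => ax; first by rewrite subrr normr0.
by rewrite !ler0_norm; lra.
Qed.

(** If p y < p x, then x is at least the midpoint of p y and p x, since p x is
    as close to x as p y is; likewise y is at most this midpoint, so y <= x.
    Ties are harmless because p is a function. *)
Lemma nearest_le (R : realType) (E : set R) (p : R -> R) (x y : R) :
  (forall x, E (p x) /\ forall e, E e -> `|x - p x| <= `|x - e|) ->
  x <= y -> p x <= p y.
Proof.
move=> hp; rewrite le_eqVlt => /predU1P[->//|xy].
have [[Ex hx] [Ey hy]] := (hp x, hp y).
rewrite leNgt; apply/negP => pp.
have := hx _ Ey; rewrite -ler_sqr ?nnegrE // !real_normK ?num_real // => h1.
have := hy _ Ex; rewrite -ler_sqr ?nnegrE // !real_normK ?num_real // => h2.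
have : 0 < (y - x) * (p x - p y) by rewrite mulr_gt0 ?subr_gt0.
lra.
Qed.

(** The triangle inequality through the old node bounds the distance from t to
    the new node by twice the distance to the old one; a node already in E is
    its own nearest point and costs nothing. *)
Lemma project_nodes (R : realType) (k n : nat) (a b : 'I_k -> R)
    (r x : 'I_n -> R) :
  (0 < k)%N -> (forall l, a l < b l) -> let E := interval_union a b in
  (forall j, 0 < r j) -> ordered_nodes x ->
  exists x', [/\ ordered_nodes x', forall j, E (x' j) &
    forall t, E t ->
      gprod r x' t <= 2 `^ (\sum_(j in off_nodes E x) r j) * gprod r x t].
Proof.
move=> k0 hab E r0 xo.
have [p hp] := nearest_point k0 hab.
exists (p \o x); split.
- by move=> i j /xo; exact: nearest_le.
- by move=> j; have [] := hp (x j).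
move=> t Et; rewrite /gprod.
have -> : 2 `^ (\sum_(j in off_nodes E x) r j) =
    \prod_(j < n) (if j \in off_nodes E x then 2 `^ r j else 1).
  rewrite -big_mkcond /=.
  apply: (big_morph (fun s : R => 2 `^ s)); last exact: powRr0.
  by move=> u v; rewrite powRD // pnatr_eq0 implybT.
rewrite -big_split /=; apply: ler_prod => j _; rewrite powR_ge0 /=.
have [Ep hj] := hp (x j).
case: ifPn => [_|]; last first.
  move=> /offP/contrapT Exj; rewrite mul1r.
  have := hj _ Exj; rewrite subrr normr0 normr_le0 subr_eq0 => /eqP <-.
  exact: lexx.
rewrite -powRM //; apply: le_powR => //.
have := hj _ Et; have := ler_normD (t - x j) (x j - p (x j)).
by rewrite addrA subrK (distrC (x j) t); lra.
Qed.

Lemma clamp_nodes (R : realType) (k n : nat) (a b : 'I_k -> R)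
    (r x : 'I_n -> R) :
  (0 < k)%N -> (forall l, a l < b l) -> let E := interval_union a b in
  (forall j, 0 < r j) -> ordered_nodes x ->
  exists x', [/\ ordered_nodes x', forall j, in_hull E (x' j) &
    forall t, E t -> gprod r x' t <= gprod r x t].
Proof.
move=> k0 hab E r0 xo.
pose la := [arg min_(l < Ordinal k0) a l]%O.
pose lb := [arg max_(l > Ordinal k0) b l]%O.
pose A := a la; pose B := b lb.
have EA : E A by exists la => //=; rewrite in_itv /= lexx (ltW (hab _)).
have EB : E B by exists lb => //=; rewrite in_itv /= lexx (ltW (hab _)).
have EAB e : E e -> A <= e <= B.
  move=> [l _ /=]; rewrite in_itv /= => /andP[ae eb].
  rewrite /A /B /la /lb; case: arg_minP => // m _ /(_ l isT) hA.
  case: arg_maxP => // m' _ /(_ l isT) hB.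
  by rewrite (le_trans hA ae) (le_trans eb hB).
have AB : A <= B by have /andP[] := EAB _ EA.
exists (fun j => Num.max A (Num.min B (x j))); split.
- by move=> i j /xo ij; apply: le_max2 => //; apply: le_min2.
- move=> j; split; first by exists A; rewrite ?le_max ?lexx.
  by exists B => //; rewrite ge_max AB ge_min lexx.
move=> t /EAB /andP[At tB]; apply: ler_prod => j _; rewrite powR_ge0 /=.
apply: le_powR => //.
rewrite /Num.max /Num.min; case: (ltP B (x j)) => Bx.
  by case: ltP => ?; rewrite !ler0_norm; lra.
by case: ltP => ? //; rewrite !ger0_norm; lra.
Qed.

(** * Comparison of the two constants *)

Lemma restricted_nodes (R : realType) (k n : nat) (a b : 'I_k -> R)
    (r x : 'I_n -> R) (F : R) :
  (0 < k)%N -> (forall l, a l < b l) -> let E := interval_union a b in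
  (forall j, 0 < r j) -> ordered_nodes x ->
  (forall A : {set 'I_n}, (#|A| <= k.-1)%N -> 2 `^ (\sum_(j in A) r j) <= F) ->
  exists x', [/\ ordered_nodes x', forall j, E (x' j) &
    forall t, E t -> gprod r x' t <= F * gprod r x t].
Proof.
move=> k0 hab E r0 xo hF.
have [y [yo yE yx]] := clamp_nodes k0 hab r0 xo.
have [z [zo zE zy zs]] := separate_nodes hab r0 yo yE.
have [u [uo uE uz]] := project_nodes k0 hab r0 zo.
exists u; split => // t Et; apply: (le_trans (uz _ Et)).
apply: ler_pM; rewrite ?powR_ge0 //.
- by apply: prodr_ge0 => j _; exact: powR_ge0.
- exact/hF/card_off_separated.
- exact: le_trans (zy _ Et) (yx _ Et).
Qed.

Lemma normc_ge_Re (R : realType) (t x y : R) :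
  `|t - x| <= ComplexField.Normc.normc (t%:C - (x +i* y))%C.
Proof.
by rewrite /= -[leLHS]sqrtr_sqr ler_wsqrtr // lerDl sqr_ge0.
Qed.

Lemma normc_real (R : realType) (t x : R) :
  ComplexField.Normc.normc (t%:C - (x +i* 0))%C = `|t - x|.
Proof. by rewrite /= subr0 expr0n /= addr0 sqrtr_sqr. Qed.

Lemma unrestricted_le_restricted (R : realType) (n : nat) (r : 'I_n -> R)
    (E : set R) (w : R -> R) :
  (unrestricted_constant r E w <= restricted_constant r E w)%E.
Proof.
apply: ereal_inf_le_tmp => _ [Q [x [_ xo ->]] <-].
eexists; last reflexivity.
exists x, (fun=> 0); split => //.
by apply/funext => t; apply: eq_bigr => j _; rewrite normc_real.
Qed.

(** The bound F is left abstract because the two parts of the theorem use it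
    with different expressions, [BC_factor k r] and 2 ^+ k.-1. *)
Lemma restricted_le_unrestricted (R : realType) (k n : nat) (a b : 'I_k -> R)
    (r : 'I_n -> R) (w : R -> R) (F : R) :
  (0 < k)%N -> (forall l, a l < b l) -> let E := interval_union a b in
  (forall t, E t -> 0 <= w t) -> (forall j, 0 < r j) ->
  (forall A : {set 'I_n}, (#|A| <= k.-1)%N -> 2 `^ (\sum_(j in A) r j) <= F) ->
  (restricted_constant r E w <= F%:E * unrestricted_constant r E w)%E.
Proof.
move=> k0 hab E w0 r0 hF.
have F0 : 0 < F.
  have /hF : (#|(finset.set0 : {set 'I_n})| <= k.-1)%N by rewrite cards0.
  by apply: lt_le_trans; rewrite powR_gt0.
rewrite -ereal_inf_pZl //.
apply: le_ereal_inf_tmp => _ [_ [Q [x [y [xo ->]]] <-] <-].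
have [x' [x'o x'E x'x]] := restricted_nodes k0 hab r0 xo hF.
apply: (@le_trans _ _ (wnorm E w (gprod r x'))).
  by apply: ereal_inf_lbound; exists (gprod r x') => //; exists x'.
apply: ge_ereal_sup => _ [t Et <-].
rewrite -lee_pdivrMl //.
apply: le_trans; last by apply: ereal_sup_ubound; exists t => //; reflexivity.
rewrite -EFinM lee_fin mulrA ler_wpM2r ?w0 //.
rewrite ler_pdivrMl // !ger0_norm; last 2 first.
- by apply: prodr_ge0 => j _; exact: powR_ge0.
- by apply: prodr_ge0 => j _; exact: powR_ge0.
apply: (le_trans (x'x _ Et)); rewrite ler_wpM2l ?(ltW F0) //.
apply: ler_prod => j _; rewrite powR_ge0 /=.
exact/le_powR/normc_ge_Re.
Qed.

(** * The two expressions of the constant *)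

Lemma subset_of_card (T : finType) (m : nat) (A : {set T}) :
  (#|A| <= m <= #|T|)%N -> exists2 B : {set T}, A \subset B & #|B| = m.
Proof.
move=> /andP[Am mT]; have [d] := ubnP (m - #|A|)%N.
elim: d A Am => // d IH A Am; rewrite ltnS => hd.
have [<-|neq] := eqVneq #|A| m; first by exists A.
have ltAm : (#|A| < m)%N by rewrite ltn_neqAle neq.
have [x xA] : exists x, x \notin A.
  apply/existsP; rewrite -negb_forall; apply/negP => /forallP h.
  move: ltAm; have -> : A = [set: T]%SET by apply/setP => y; rewrite h inE.
  by rewrite cardsT ltnNge mT.
have cA : #|x |: A|%SET = #|A|.+1 by rewrite cardsU1 xA.
have [||B AB Bm] := IH (x |: A)%SET; rewrite ?cA //.
  by rewrite subnSK.
by exists B => //; apply: fintype.subset_trans AB; exact: finset.subsetUr.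
Qed.

Lemma sum_increasing_index (R : realType) (n m : nat) (r : 'I_n -> R)
    (B : {set 'I_n}) : (0 < n)%N -> #|B| = m ->
  exists2 i : {ffun 'I_m -> 'I_n},
    (forall p q : 'I_m, (p < q)%N -> (i p < i q)%N) &
    \sum_(p < m) r (i p) = \sum_(j in B) r j.
Proof.
move=> n0 Bm; pose j0 := Ordinal n0.
have szB : size (enum B) = m by rewrite -cardE.
exists [ffun p : 'I_m => nth j0 (enum B) p].
  move=> p q pq; rewrite !ffunE.
  have srt : sorted (relpre val ltn) (enum B).
    rewrite /enum_mem.
    apply: sorted_filter; first by move=> x y z; exact: ltn_trans.
    by rewrite -enumT -sorted_map val_enum_ord iota_ltn_sorted.
  have tr : transitive (relpre val ltn : rel 'I_n).
    by move=> x y z; exact: ltn_trans.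
  by apply: (sorted_ltn_nth tr j0 srt); rewrite ?inE ?szB ?ltn_ord.
rewrite -[RHS](big_enum _ 0%R) (big_nth j0) szB big_mkord.
by apply: eq_bigr => p _; rewrite ffunE.
Qed.

(** Since the exponents are positive and k - 1 <= n, enlarging an index set to
    exactly k - 1 elements only increases the sum; and sets of that cardinality
    correspond to increasing index systems by listing their elements in
    order. *)
Lemma BC_factor_increasingE (R : realType) (k n : nat) (r : 'I_n -> R) :
  (0 < n)%N -> (forall j, 0 < r j) -> (k.-1 <= n)%N ->
  BC_factor k r = BC_factor_increasing k r.
Proof.
move=> n0 r0 kn; congr (_ `^ _); apply/le_anti/andP; split.
  apply: bigmax_le => [|A Ak]; first exact: bigmax_ge_id.
  have [|B AB Bk] := @subset_of_card _ k.-1 A; first by rewrite Ak card_ord.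
  have [i iB sB] := @sum_increasing_index R n k.-1 r B n0 Bk.
  apply: (@le_trans _ _ (\sum_(p < k.-1) r (i p))).
    rewrite sB [leRHS](big_setID A) /= (finset.setIidPr AB) lerDl.
    by apply: sumr_ge0 => j _; exact: ltW.
  apply: (le_bigmax_cond _
    (fun i : {ffun 'I_k.-1 -> 'I_n} => \sum_(p < k.-1) r (i p))).
  by apply/forallP => p; apply/forallP => q; apply/implyP; exact: iB.
apply: bigmax_le => [|i /forallP iP]; first exact: bigmax_ge_id.
have inj : injective i.
  move=> p q epq; case: (ltngtP p q) => [pq|qp|/val_inj //].
    by have := forallP (iP p) q; rewrite pq epq ltnn.
  by have := forallP (iP q) p; rewrite qp epq ltnn.
have -> : \sum_(p < k.-1) r (i p) = \sum_(j in (i @: [set: 'I_k.-1])%SET) r j.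
  rewrite big_imset /=; last by move=> p q _ _; exact: inj.
  by apply: eq_bigl => p; rewrite inE.
apply: (le_bigmax_cond _ (fun A : {set 'I_n} => \sum_(j in A) r j)).
by rewrite card_imset // cardsT card_ord.
Qed.

Theorem theorem6p2 (R : realType) (k n : nat) (hk : (0 < k)%N) (hn : (0 < n)%N)
    (a b : 'I_k -> R)
    (hab : forall l : 'I_k, a l < b l)
    (hba : forall l m : 'I_k, m = l.+1 :> nat -> b l < a m)
    (w : R -> R)
    (hw0 : forall t, interval_union a b t -> 0 <= w t)
    (hwusc : upper_semicontinuous_on (interval_union a b) w)
    (hwn : (n%:R%:E <
       \esum_(t in [set t | interval_union a b t /\ w t != 0%R])
          (point_weight (a (Ordinal hk)) (b (rev_ord (Ordinal hk))) t)%:E)%E) :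
  let E := interval_union a b in
  (forall r : 'I_n -> R, (forall j, 0 < r j) ->
     [/\ (unrestricted_constant r E w <= restricted_constant r E w)%E,
         (restricted_constant r E w
            <= (BC_factor k r)%:E * unrestricted_constant r E w)%E &
         (k.-1 <= n)%N -> BC_factor k r = BC_factor_increasing k r]) /\
  (let one := fun _ : 'I_n => 1 : R in
   (unrestricted_constant one E w <= restricted_constant one E w)%E /\
   (restricted_constant one E w
      <= (2 ^+ k.-1)%:E * unrestricted_constant one E w)%E).
Proof.
move=> E; split=> [r r0|one]; split.
- exact: unrestricted_le_restricted.
- apply: restricted_le_unrestricted => // A Ak.
  apply: ler_powR; first by rewrite ler1n.
  exact: (le_bigmax_cond _ (fun A : {set 'I_n} => \sum_(j in A) r j)).
- exact: BC_factor_increasingE.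
- exact: unrestricted_le_restricted.
- apply: restricted_le_unrestricted => // A Ak.
  rewrite /one sumr_const powR_mulrn //.
  by rewrite ler_weXn2l ?ler1n.
Qed.
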